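(* Let $K$ be a field, $S=K[x_1,\ldots,x_n]$, and let $I\subset S$ be an equigenerated monomial ideal with analytic spread $\ell=\ell(I)$ whose fiber cone $F(I)$ is Cohen--Macaulay. Then the following are equivalent: (i) $I$ is Freiman; (ii) $\mu(I^k)=\binom{\ell+k-2}{k-1}\mu(I)-(k-1)\binom{\ell+k-2}{k}$ for all $k\ge 2$; (iii) $\mu(I^k)=\binom{\ell+k-2}{k-1}\mu(I)-(k-1)\binom{\ell+k-2}{k}$ for some $k\ge 2$.
   Context: $\mathfrak m=(x_1,\ldots,x_n)$. For a graded ideal $I\subset S$, $\mu(I)$ denotes the minimal number of generators of $I$; the fiber cone is the standard graded $K$-algebra $F(I)=\bigoplus_{k\ge 0} I^k/\mathfrak m I^k$, and the analytic spread $\ell(I)$ is the Krull dimension of $F(I)$. An ideal is equigenerated if all elements of a minimal set of generators have the same degree. An equigenerated monomial ideal $I$ is called Freiman if $\mu(I^2)=\ell(I)\mu(I)-\binom{\ell(I)}{2}$. *)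

(* Defs.v *)
From HB Require Import structures.
From mathcomp Require Import all_boot all_order all_algebra.
From mathcomp Require Import generic_quotient ring_quotient.
From mathcomp Require Import boolp classical_sets.
From mathcomp Require Import mpoly.

Set Implicit Arguments.
Unset Strict Implicit.
Unset Printing Implicit Defensive.

Import GRing.Theory.

Local Open Scope classical_set_scope.
Local Open Scope ring_scope.
Local Open Scope quotient_scope.

Definition is_minimum (P : set nat) (d : nat) : Prop :=
  P d /\ forall e, P e -> (d <= e)%N.

Definition is_maximum (P : set nat) (d : nat) : Prop :=
  P d /\ forall e, P e -> (e <= d)%N.

Section Ideals.
Variable R : comNzRingType.
Implicit Types (I J X : set R).

Definition is_ideal I : Prop :=
  [/\ I 0, forall x y, I x -> I y -> I (x + y) & forall a x, I x -> I (a * x)].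

Definition ideal_gen X : set R := smallest is_ideal X.

Definition ideal_mul I J : set R :=
  ideal_gen [set z | exists x y, [/\ I x, J y & z = x * y]].

Fixpoint ideal_pow I (k : nat) : set R :=
  if k is k'.+1 then ideal_mul I (ideal_pow I k') else setT.

Definition min_num_gens I : nat :=
  get [set r | is_minimum
    [set e | exists s : seq R, size s = e /\ ideal_gen [set` s] = I] r].

Definition minimal_gens (X I : set R) : Prop :=
  ideal_gen X = I /\ forall Y : set R, Y `<=` X -> ideal_gen Y = I -> Y = X.

Definition prime_ideal (P : set R) : Prop :=
  [/\ is_ideal P, ~ P 1 & forall x y, P (x * y) -> P x \/ P y].

Definition prime_chain (e : nat) : Prop :=
  exists c : nat -> set R,
    (forall i, (i <= e)%N -> prime_ideal (c i)) /\
    (forall i, (i < e)%N -> c i `<` c i.+1).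

Definition is_krull_dim (d : nat) : Prop := is_maximum prime_chain d.

Definition krull_dim : nat := get [set d | is_krull_dim d].

Definition regular_sequence (s : seq R) : Prop :=
  (forall i z, (i < size s)%N ->
     ideal_gen [set` take i s] (s`_i * z) -> ideal_gen [set` take i s] z) /\
  ~ ideal_gen [set` s] 1.

Definition is_depth J (d : nat) : Prop :=
  is_maximum [set e | exists s : seq R,
    [/\ size s = e, forall x, x \in s -> J x & regular_sequence s]] d.

(* Cohen-Macaulayness of a standard graded K-algebra R whose graded maximal
   ideal is J: the depth, i.e. the maximal length of a regular sequence in J,
   equals the Krull dimension. *)
Definition graded_cohen_macaulay J : Prop :=
  exists d, is_krull_dim d /\ is_depth J d.

Lemma ideal_gen_is_ideal X : is_ideal (ideal_gen X).
Proof.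
split=> [A [[]]//|x y Ix Iy A HA|a x Ix A HA]; have [[A0 AD AM] XA] := HA.
  by apply: AD; [exact: Ix|exact: Iy].
by apply: AM; exact: Ix.
Qed.

Lemma ideal_gen_min X I : is_ideal I -> X `<=` I -> ideal_gen X `<=` I.
Proof. by move=> HI XI x; apply; split. Qed.

Lemma ideal_gen_sub X : X `<=` ideal_gen X.
Proof. by move=> x Xx A [_]; apply. Qed.

Lemma ideal_pow_is_ideal I k : is_ideal (ideal_pow I k).
Proof. by case: k => [|k]; [split|exact: ideal_gen_is_ideal]. Qed.

Lemma ideal_gen_mulr X I y : is_ideal I -> (forall x, X x -> I (x * y)) ->
  forall x, ideal_gen X x -> I (x * y).
Proof.
move=> [I0 ID IM] XI; apply: (@ideal_gen_min X [set x | I (x * y)]) => //.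
split=> [|u v|a u] /=; first by rewrite mul0r.
  by rewrite mulrDl; exact: ID.
by rewrite -mulrA; exact: IM.
Qed.

Lemma ideal_powD I j k x y :
  ideal_pow I j x -> ideal_pow I k y -> ideal_pow I (j + k) (x * y).
Proof.
move=> + Iy; elim: j x => [|j IH] x Ix.
  by have [_ _ IM] := ideal_pow_is_ideal I k; exact: IM.
apply: (ideal_gen_mulr (ideal_pow_is_ideal I (j + k).+1) _ Ix).
move=> _ [a [b [Ia Ib ->]]]; apply: ideal_gen_sub; exists a, (b * y).
by split=> //; [exact: IH|rewrite mulrA].
Qed.

Lemma ideal_mul_powD J I j k x y :
  ideal_mul J (ideal_pow I j) x -> ideal_pow I k y ->
  ideal_mul J (ideal_pow I (j + k)) (x * y).
Proof.
move=> Jx Iy; apply: (ideal_gen_mulr (ideal_gen_is_ideal _) _ Jx).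
move=> _ [a [b [Ja Ib ->]]]; apply: ideal_gen_sub; exists a, (b * y).
by split=> //; [exact: ideal_powD|rewrite mulrA].
Qed.

Lemma ideal_sum I (T : Type) (r : seq T) (P : pred T) (F : T -> R) :
  is_ideal I -> (forall i, P i -> I (F i)) -> I (\sum_(i <- r | P i) F i).
Proof. by move=> [I0 ID _] IF; apply: big_ind. Qed.

(* The Rees algebra (+)_k I^k t^k, as the subring of R[t] of the polynomials
   whose k-th coefficient lies in I^k. *)
Definition rees_pred I : {pred {poly R}} :=
  fun p => `[< forall k, ideal_pow I k p`_k >].

Lemma rees_subring_closed I : subring_closed (rees_pred I).
Proof.
have NN k x : ideal_pow I k x -> ideal_pow I k (- x).
  by have [_ _ IM] := ideal_pow_is_ideal I k; rewrite -mulN1r; exact: IM.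
split=> [|p q /asboolP Ip /asboolP Iq|p q /asboolP Ip /asboolP Iq];
    apply/asboolP => k.
- by rewrite coef1; case: k => [|k] //=; have [] := ideal_gen_is_ideal
    [set z | exists x y, [/\ I x, ideal_pow I k y & z = x * y]].
- rewrite coefB; have [_ ID _] := ideal_pow_is_ideal I k.
  by apply: ID => //; exact: NN.
- rewrite coefM; apply: ideal_sum; first exact: ideal_pow_is_ideal.
  move=> i _; rewrite -[X in ideal_pow I X _](subnKC (leq_ord i)).
  exact: ideal_powD.
Qed.

HB.instance Definition _ I :=
  GRing.isSubringClosed.Build {poly R} (rees_pred I) (rees_subring_closed I).

Record rees I := Rees { rees_val :> {poly R}; _ : rees_val \in rees_pred I }.

HB.instance Definition _ I := [isSub for @rees_val I].
HB.instance Definition _ I := [Choice of rees I by <:].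
HB.instance Definition _ I := [SubChoice_isSubComNzRing of rees I by <:].

(* The extension to the Rees algebra of an ideal J of R: (+)_k J I^k t^k. *)
Definition rees_ext J I : {pred rees I} :=
  fun p => `[< forall k, ideal_mul J (ideal_pow I k) (val p)`_k >].

End Ideals.

Section FiberCone.
Variables (K : fieldType) (n : nat).
Implicit Type I : set {mpoly K[n]}.

Definition max_ideal : set {mpoly K[n]} :=
  ideal_gen (range (fun i : 'I_n => 'X_i)).

Lemma max_ideal_eval0 p : max_ideal p -> p.@[fun=> 0] = 0.
Proof.
apply: (@ideal_gen_min _ _ [set q | q.@[fun=> 0] = 0]).
  split=> [|p1 p2|a p1] /=; first exact: meval0.
    by rewrite mevalD => -> ->; rewrite addr0.
  by rewrite mevalM => ->; rewrite mulr0.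
by move=> _ [i _ <-] /=; rewrite mevalXU.
Qed.

Lemma rees_max_idealr_closed I : idealr_closed (@rees_ext _ max_ideal I).
Proof.
split.
- apply/asboolP => k; rewrite rmorph0 coef0.
  by have [] := ideal_gen_is_ideal
    [set z | exists x y, [/\ max_ideal x, ideal_pow I k y & z = x * y]].
- apply/asboolP => /(_ 0); rewrite rmorph1 coef1 /= => m1.
  suff /max_ideal_eval0 : max_ideal 1 by rewrite meval1 => /eqP; rewrite oner_eq0.
  move: m1; apply: ideal_gen_min; first exact: ideal_gen_is_ideal.
  move=> _ [x [y [mx _ ->]]]; rewrite mulrC.
  by have [_ _] := ideal_gen_is_ideal (range (fun i : 'I_n => 'X_i : {mpoly K[n]}));
     apply.
- move=> a p q /asboolP mp /asboolP mq; apply/asboolP => k.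
  rewrite rmorphD rmorphM /= coefD.
  have [_ mD _] := ideal_gen_is_ideal
    [set z | exists x y, [/\ max_ideal x, ideal_pow I k y & z = x * y]].
  apply: mD; last exact: mq.
  rewrite mulrC coefM; apply: ideal_sum; first exact: ideal_gen_is_ideal.
  move=> i _; rewrite -[X in ideal_pow I X](subnKC (leq_ord i)).
  apply: ideal_mul_powD; first exact: mp.
  by have /asboolP := valP a; apply.
Qed.

HB.instance Definition _ I :=
  isIdealr.Build (rees I) (@rees_ext _ max_ideal I) (rees_max_idealr_closed I).

(* F(I) = (+)_k I^k / m I^k, as the quotient of (+)_k I^k t^k by
   (+)_k m I^k t^k. *)
Definition fiber_cone I : comNzRingType :=
  {ideal_quot (@rees_ext _ max_ideal I)}.

(* (+)_(k >= 1) I^k / m I^k; since I^0 / m I^0 = S / m = K, this is the graded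
   maximal ideal of F(I). *)
Definition fiber_cone_max I : set (fiber_cone I) :=
  [set x | exists2 p : rees I, (val p)`_0 = 0 & x = \pi_(fiber_cone I) p].

Definition analytic_spread I : nat := krull_dim (fiber_cone I).

Definition monomial_ideal I : Prop :=
  exists M : set 'X_{1..n}, I = ideal_gen [set 'X_[m] | m in M].

(* Generators of a graded ideal are understood to be homogeneous. *)
Definition equigenerated I : Prop :=
  exists (X : set {mpoly K[n]}) (d : nat),
    minimal_gens X I /\ forall f, X f -> f \is d.-homog.

Definition freiman I : Prop :=
  [/\ monomial_ideal I, equigenerated I
    & let l := analytic_spread I in
      (min_num_gens (ideal_pow I 2))%:Z =
        l%:Z * (min_num_gens I)%:Z - 'C(l, 2)%:Z].

End FiberCone.

(* Main.v *)
Require Import Defs.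
From HB Require Import structures.
From mathcomp Require Import all_boot all_order all_algebra.
From mathcomp Require Import generic_quotient ring_quotient.
From mathcomp Require Import boolp classical_sets.
From mathcomp Require Import mpoly.
From mathcomp Require Import ring zify.

Set Implicit Arguments.
Unset Strict Implicit.
Unset Printing Implicit Defensive.

Import GRing.Theory.

Local Open Scope classical_set_scope.
Local Open Scope ring_scope.
Local Open Scope quotient_scope.

(** Write [F] for the fiber cone, [l] for its dimension and [H k] for the number
    of generators of [I^k], which is the dimension of the degree [k] part of
    [F].  If a sequence of [l] linear forms is regular on [F], then dividing by
    it replaces the Hilbert function by its successive differences, so that [H]
    is the [l]-fold iterated sum of the Hilbert function [h] of a quotient of
    [F] generated in degree one.  Such an [h] is nonnegative and stays zero once
    it vanishes.  The formula in the theorem, in degree [k], says that [H k] is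
    what [h 0 = 1] and [h 1] alone contribute to the iterated sum; as all the
    terms are nonnegative, it forces [h 2 = 0], hence [h i = 0] for all
    [i >= 2], hence the formula in every degree.  The Freiman condition is the
    formula in degree two.

    Cohen-Macaulayness gives a regular sequence [x_1, ..., x_l] of elements of
    the irrelevant ideal, not of linear forms, and the field may be finite.
    Both points are settled by a generic linear form: if [y_0, y_1, ...]
    generate the irrelevant ideal, take [theta = y_0 + y_1 u + y_2 u^2 + ...]
    over the polynomial ring in a new variable [u].  By McCoy's theorem
    ([mccoy]) a polynomial is regular modulo [N[u]] as soon as no element
    outside [N] is multiplied into [N] by all of its coefficients.  Hence
    [theta] is regular modulo each of the ideals [(x_1, ..., x_i)] with
    [i < l], because [x_(i+1)] is.  It can then be moved to the front: modulo
    [theta] the sequence [x_1, ..., x_(l-1)] is still regular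
    ([regular_mod_generic]), and an induction on [l] applies to the quotient by
    [theta] ([hilbert_of_regular_sequence]).

    To make this induction run over [K], [K[u_1]], [K[u_1, u_2]], ... the
    dimensions are ranks of modules over integral domains, torsion being
    neglected: adjoining a variable to both the domain and the algebra does not
    change ranks ([has_rank_poly_ext]).  The Krull dimension enters only as the
    length of the given regular sequence.

    The Rees algebra modulo the kernel of its projection to [F] is the algebra
    to which this is applied.  Since [I] is generated in one degree [d], so is
    [I^k] in degree [d * k], while the nonzero elements of [m I^k] only have
    terms of larger degree; so a [K]-basis of the degree [d * k] part of [I^k]
    is a smallest set of generators of [I^k] and a basis of [I^k / m I^k]
    ([minimal_homogeneous_basis], [min_num_gensE]). *)

(** * Ideals as sets *)

Section IdealFacts.
Variables (R : comNzRingType) (N : set R).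
Hypothesis idN : is_ideal N.

Lemma is_ideal0 : N 0. Proof. by case: idN. Qed.

Lemma is_idealD x y : N x -> N y -> N (x + y).
Proof. by case: idN => _ + _; apply. Qed.

Lemma is_idealMl a x : N x -> N (a * x).
Proof. by case: idN => _ _; apply. Qed.

Lemma is_idealMr a x : N x -> N (x * a).
Proof. by rewrite mulrC; exact: is_idealMl. Qed.

Lemma is_idealN x : N x -> N (- x).
Proof. by rewrite -mulN1r; exact: is_idealMl. Qed.

Lemma is_idealB x y : N x -> N y -> N (x - y).
Proof. by move=> Nx /is_idealN; exact: is_idealD. Qed.

Lemma is_idealBr x y : N (x - y) -> N y -> N x.
Proof. by move=> Nxy Ny; rewrite -[x](subrK y); exact: is_idealD. Qed.

End IdealFacts.

Lemma zero_is_ideal (R : comNzRingType) : is_ideal [set 0 : R].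
Proof. by split=> [//|x y -> ->|a x ->]; rewrite /= ?addr0 ?mulr0. Qed.

(** * Ranks of modules over an integral domain *)

Section Rank.
Variables (D : idomainType) (R : comNzRingType) (phi : {rmorphism D -> R}).
Implicit Types (N W : set R) (T : finType).

Definition free_mod N T (b : T -> R) : Prop :=
  forall c : T -> D, N (\sum_i phi (c i) * b i) -> forall i, c i = 0.

(** Some nonzero multiple of [w] lies in the span of [b] modulo [N]: this is
    membership in the span after passing to the field of fractions of [D]. *)
Definition torsion_span N T (b : T -> R) (w : R) : Prop :=
  exists c0 (c : T -> D), c0 != 0 /\ N (phi c0 * w - \sum_i phi (c i) * b i).

(** The dimension of [W / N] over the field of fractions of [D]. *)
Definition has_rank W N (d : nat) : Prop :=
  exists (T : finType) (b : T -> R),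
    [/\ #|T| = d, forall i, W (b i), free_mod N b
      & forall w, W w -> torsion_span N b w].

(** Padded with zero columns, the matrix is square with determinant zero. *)
Lemma wide_matrix_kernel p q (M : 'M[D]_(p, q)) : (q < p)%N ->
  exists2 v : 'rV_p, v != 0 & v *m M = 0.
Proof.
move=> lt_qp.
pose M' : 'M[D]_p :=
  \matrix_(i, j) (if insub (j : nat) is Some j' then M i j' else 0).
have /det0P[v v0 vM'] : \det M' == 0.
  rewrite (expand_det_col _ (Ordinal lt_qp)) big1 // => i _.
  by rewrite mxE insubF /= ?ltnn // mul0r.
exists v => //; apply/rowP => j.
move/rowP/(_ (widen_ord (ltnW lt_qp) j)): vM'; rewrite !mxE => sum0.
by rewrite -[RHS]sum0; apply: eq_bigr => i _; rewrite mxE /= valK.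
Qed.

(** Steinitz: after clearing denominators, too long a free family would give a
    matrix with more rows than columns, whose kernel yields a relation. *)
Lemma card_free_leq N T1 (b1 : T1 -> R) T2 (b2 : T2 -> R) : is_ideal N ->
    free_mod N b1 -> (forall i, torsion_span N b2 (b1 i)) ->
  (#|T1| <= #|T2|)%N.
Proof.
move=> idN free1 span2; rewrite leqNgt; apply/negP => lt21.
have [c0 /choice[c cP]] := choice span2.
have [v v0 vM] := wide_matrix_kernel
  (\matrix_(i < #|T1|, j < #|T2|) c (enum_val i) (enum_val j)) lt21.
case/negP: v0; apply/eqP/rowP => i; rewrite mxE.
have sum0 j : \sum_k v ord0 (enum_rank k) * c k j = 0.
  move/rowP/(_ (enum_rank j)): vM; rewrite !mxE => sum0.
  rewrite -[RHS]sum0 (reindex _ (onW_bij _ (@enum_val_bij T1)));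
    apply: eq_bigr => k _.
  by rewrite mxE enum_valK enum_rankK.
have /(_ _ (enum_val i)) := free1 (fun k => v ord0 (enum_rank k) * c0 k).
rewrite enum_valK => vc0; apply/eqP.
suff /vc0/eqP : N (\sum_k phi (v ord0 (enum_rank k) * c0 k) * b1 k).
  by rewrite mulf_eq0 (negbTE (cP _).1) orbF.
have -> : \sum_k phi (v ord0 (enum_rank k) * c0 k) * b1 k =
   \sum_k phi (v ord0 (enum_rank k)) *
      (phi (c0 k) * b1 k - \sum_j phi (c k j) * b2 j).
  have s0 : \sum_j phi (\sum_k v ord0 (enum_rank k) * c k j) * b2 j = 0.
    by rewrite big1 // => j _; rewrite sum0 rmorph0 mul0r.
  rewrite -[LHS]subr0 -[X in _ - X]s0.
  under [X in _ - X]eq_bigr => j _ do rewrite rmorph_sum mulr_suml.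
  rewrite exchange_big /= -sumrB; apply: eq_bigr => k _.
  rewrite mulrBr mulr_sumr rmorphM mulrA; congr (_ - _).
  by apply: eq_bigr => j _; rewrite rmorphM mulrA.
apply: ideal_sum => // k _; apply: is_idealMl => //; exact: (cP k).2.
Qed.

Lemma has_rank_uniq W N d1 d2 : is_ideal N ->
  has_rank W N d1 -> has_rank W N d2 -> d1 = d2.
Proof.
move=> idN [T1 [b1 [<- W1 f1 s1]]] [T2 [b2 [<- W2 f2 s2]]].
by apply/eqP; rewrite eqn_leq; apply/andP; split;
  [apply: (card_free_leq idN f1) => i; exact/s2
  |apply: (card_free_leq idN f2) => i; exact/s1].
Qed.

(** A free family of largest size in [W] spans, since adding a further
    element of [W] makes a relation in which that element occurs. *)
Lemma has_rank_exists W N T (b : T -> R) : is_ideal N ->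
  (forall w, W w -> torsion_span N b w) -> exists d, has_rank W N d.
Proof.
move=> idN Wb.
pose P d := `[< exists (T' : finType) (b' : T' -> R),
  [/\ #|T'| = d, forall i, W (b' i) & free_mod N b'] >].
have P0 : exists d, P d.
  exists 0; apply/asboolP; exists void, (of_void R).
  by split=> [|[]|? ? []]; rewrite ?card_void.
have Pb d : P d -> (d <= #|T|)%N.
  case/asboolP=> T' [b' [<- Wb' f']]; apply: (card_free_leq idN f').
  by move=> i; exact/Wb.
case: (ex_maxnP P0 Pb) => d /asboolP[T' [b' [dE W' f']]] dmax.
exists d, T', b'; split=> // w Ww; apply: contrapT => nspan.
pose b1 (x : option T') := if x is Some i then b' i else w.
suff /dmax : P d.+1 by rewrite ltnn.
apply/asboolP; exists (option T'), b1; split=> [|[]//|c].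
  by rewrite card_option dE.
have -> : \sum_i phi (c i) * b1 i =
    phi (c None) * w + \sum_i phi (c (Some i)) * b' i.
  rewrite (bigD1 None) //=; congr (_ + _).
  rewrite (reindex_omap Some id) /=; last by case.
  by apply: eq_bigl => i; rewrite eqxx.
move=> Nc; have c0 : c None = 0.
  apply: contrapT => /eqP c0; apply: nspan.
  exists (c None), (fun i => - c (Some i)); split=> //.
  by under eq_bigr => i _ do rewrite rmorphN mulNr; rewrite sumrN opprK.
move: Nc; rewrite c0 rmorph0 mul0r add0r => /f' cS.
by case.
Qed.

(** Additivity along [0 -> W1 / N -> W / N -> W / N' -> 0], where [W1] stands
    for [W] intersected with [N'], up to [N]. *)
Lemma has_rankD W N N' W1 d' d1 : is_ideal N -> is_ideal N' -> N `<=` N' ->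
    W1 `<=` W `&` N' ->
    (forall w, W w -> N' w -> exists2 w1, W1 w1 & N (w - w1)) ->
    (forall c a b, W a -> W b -> W (phi c * a + b)) ->
  has_rank W N' d' -> has_rank W1 N d1 -> has_rank W N (d1 + d').
Proof.
move=> idN idN' NN' W1W WN' Wlin.
move=> [T [b [<- Wb fb sb]]] [T1 [b1 [<- Wb1 fb1 sb1]]].
have phiN c a : W a -> W (phi c * a).
  move=> Wa; have W0 : W 0.
    by have := Wlin (-1) _ _ Wa Wa; rewrite rmorphN rmorph1 mulN1r addNr.
  by rewrite -[_ * _]addr0; exact: Wlin.
pose bb (x : T1 + T) := match x with inl i => b1 i | inr i => b i end.
exists (T1 + T)%type, bb.
have sumE (c : T1 + T -> D) : \sum_i phi (c i) * bb i =
    \sum_i phi (c (inl i)) * b1 i + \sum_i phi (c (inr i)) * b i.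
  by rewrite big_sumType.
split=> [|[i|i]|c|w Ww].
- by rewrite card_sum.
- by case: (W1W _ (Wb1 i)).
- exact: Wb.
- rewrite sumE => Nc.
  have cr i : c (inr i) = 0.
    apply: (fb (fun i => c (inr i))).
    rewrite -[\sum_i _](addKr (\sum_i phi (c (inl i)) * b1 i)).
    apply: is_idealD => //; last exact: NN'.
    apply: is_idealN => //; apply: ideal_sum => // j _; apply: is_idealMl => //.
    by case: (W1W _ (Wb1 j)).
  case=> // i; apply: (fb1 (fun i => c (inl i))).
  by move: Nc; rewrite [X in _ + X]big1 ?addr0 // => j _;
    rewrite cr rmorph0 mul0r.
- have [c0 [c [c00 Nw]]] := sb _ Ww.
  have [|w1 /sb1[e0 [e [e00 Ne]]] Nw1] := WN' _ _ Nw.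
    rewrite -sumrN; have := phiN c0 _ Ww; move: (phi c0 * w) => v Wv.
    elim/big_rec: _ => [|i x _]; first by rewrite addr0.
    move=> Wx; rewrite addrCA -mulNr -rmorphN; exact: Wlin.
  exists (e0 * c0).
  exists (fun x => match x with inl i => e i | inr i => e0 * c i end).
  rewrite mulf_neq0 //; split=> //; rewrite sumE /=.
  have -> : \sum_i phi (e0 * c i) * b i = phi e0 * \sum_i phi (c i) * b i.
    by rewrite mulr_sumr; apply: eq_bigr => i _; rewrite rmorphM mulrA.
  rewrite rmorphM.
  have -> : forall s s1, phi e0 * phi c0 * w - (s1 + phi e0 * s) =
    phi e0 * ((phi c0 * w - s) - w1) + (phi e0 * w1 - s1) by move=> *; ring.
  by apply: is_idealD => //; exact: is_idealMl.
Qed.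

End Rank.

(** * McCoy's theorem and generic linear forms *)

Definition adjoin (R : comNzRingType) (N : set R) (x : R) : set R :=
  [set a | exists n z, N n /\ a = n + x * z].

(** Regularity on the quotient by [N], stated by adjoining the elements one by
    one so that the whole development may argue by induction on the sequence. *)
Fixpoint regular_mod (R : comNzRingType) (N : set R) (s : seq R) : Prop :=
  if s is x :: s' then
    (forall z, N (x * z) -> N z) /\ regular_mod (adjoin N x) s'
  else True.

Definition poly_ext (R : comNzRingType) (N : set R) : set {poly R} :=
  [set p | forall i, N p`_i].

Section Adjoin.
Variable R : comNzRingType.
Implicit Types (N : set R).

Lemma adjoin_ideal N x : is_ideal N -> is_ideal (adjoin N x).
Proof.
move=> idN; split.
- by exists 0, 0; rewrite mulr0 addr0; split=> //; exact: is_ideal0.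
- move=> _ _ [n1 [z1 [N1 ->]]] [n2 [z2 [N2 ->]]]; exists (n1 + n2), (z1 + z2).
  by split; [exact: is_idealD|ring].
- move=> a _ [n [z [Nn ->]]]; exists (a * n), (a * z).
  by split; [exact: is_idealMl|ring].
Qed.

Lemma sub_adjoin N x : N `<=` adjoin N x.
Proof. by move=> n Nn; exists n, 0; rewrite mulr0 addr0. Qed.

Lemma adjoinAC N (x1 x2 : R) :
  adjoin (adjoin N x1) x2 = adjoin (adjoin N x2) x1.
Proof.
apply/seteqP; split=> _ [_ [z [[n [w [Nn ->]]] ->]]].
  by exists (n + x2 * z), w; split; [exists n, z|ring].
by exists (n + x1 * z), w; split; [exists n, z|ring].
Qed.

End Adjoin.

Section Extensions.
Variable R : comNzRingType.
Implicit Types (N : set R) (s y : seq R).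

Lemma poly_ext_ideal N : is_ideal N -> is_ideal (poly_ext N).
Proof.
move=> idN; split=> [i|p q Np Nq i|a p Np i].
- by rewrite coef0; exact: is_ideal0.
- by rewrite coefD; exact: is_idealD.
- by rewrite coefM; apply: ideal_sum => // j _; exact: is_idealMl.
Qed.

Lemma poly_ext_adjoin N x : is_ideal N ->
  poly_ext (adjoin N x) = adjoin (poly_ext N) x%:P.
Proof.
move=> idN; apply/seteqP; split=> p; last first.
  move=> [q [r [Nq ->]]] i; rewrite coefD coefCM.
  by exists q`_i, r`_i; split=> //; exact: Nq.
move=> /choice[f /choice[g fg]]; pose r := \poly_(i < size p) g i.
exists (p - x%:P * r), r; split=> [i|]; last by rewrite subrK.
rewrite coefB coefCM coef_poly; case: ltnP => [_|le_p_i].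
  by have [Nf ->] := fg i; rewrite addrK.
by rewrite nth_default // mulr0 subr0; exact: is_ideal0.
Qed.

(** McCoy's theorem for the module [R / N]: a polynomial kills a nonzero
    polynomial modulo [N] only if its coefficients kill a nonzero constant.  By
    induction on the size of [z], it is enough that the top coefficient of [z]
    lies in [N], and for this that every [f`_i] multiplies it into [N].  Going
    down from the largest [i], the coefficient of [f * z] in degree
    [i + s.-1] is [f`_i] times the top coefficient modulo [N], so [f`_i *: z]
    is shorter than [z] modulo [N] and the induction on size applies to it. *)
Lemma mccoy N (f z : {poly R}) : is_ideal N ->
    (forall m, (forall i, N (f`_i * m)) -> N m) ->
  poly_ext N (f * z) -> poly_ext N z.
Proof.
move=> idN Nf; have idNu := poly_ext_ideal idN.
have [s] := ubnP (size z); elim: s z => // s IHs z; rewrite ltnS => le_z_s Nfz.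
have [s0|s_gt0] := posnP s.
  move: le_z_s; rewrite s0 leqn0 size_poly_eq0 => /eqP->; exact: is_ideal0.
have trim (w : {poly R}) : (size w <= s)%N -> poly_ext N (f * w) ->
    N w`_s.-1 -> poly_ext N w.
  move=> le_w_s Nfw Nlead.
  have Ntop : poly_ext N (w`_s.-1 *: 'X^(s.-1)).
    by move=> i; rewrite coefZ; exact: is_idealMr.
  apply: (is_idealBr idNu) (Ntop); apply: IHs.
    rewrite -(prednK s_gt0) ltnS; apply/leq_sizeP => j.
    rewrite coefB coefZ coefXn leq_eqVlt => /predU1P[<-|lt_s_j].
      by rewrite eqxx mulr1 subrr.
    rewrite gtn_eqF // mulr0 subr0 nth_default //; apply: leq_trans le_w_s _.
    by rewrite -(prednK s_gt0).
  by rewrite mulrBr; apply: (is_idealB idNu) => //; exact: (is_idealMl idNu).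
(* Induction from the top: q bounds how far i lies below the size of f. *)
have Nfiz q : forall i, (size f <= i + q)%N -> poly_ext N (f`_i *: z).
  elim: q => [|q IHq] i.
    by rewrite addn0 => le_f_i; rewrite nth_default // scale0r;
      exact: is_ideal0.
  move=> le_f_iq; apply: trim.
  - exact: leq_trans (size_scale_leq _ _) le_z_s.
  - by rewrite -mul_polyC mulrCA; exact: (is_idealMl idNu).
  - rewrite coefZ; have := Nfz (i + s.-1)%N.
    have lt_i : (i < (i + s.-1).+1)%N by rewrite ltnS leq_addr.
    rewrite coefM (bigD1 (Ordinal lt_i)) //= addKn.
    rewrite -[X in N (_ + X)]opprK => /(is_idealBr idN); apply.
    apply: is_idealN => //; apply: ideal_sum => // j ne_ji.
    have [lt_ji|lt_ij|eq_ji] := ltngtP j i.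
    + rewrite (@nth_default _ _ z) ?mulr0; first exact: is_ideal0.
      apply: leq_trans le_z_s _; rewrite -{1}(prednK s_gt0); lia.
    + rewrite -coefZ; apply: IHq; lia.
    + by move: ne_ji; rewrite -val_eqE /= eq_ji eqxx.
apply: trim => //; apply: Nf => i; rewrite -coefZ.
by apply: (Nfiz (size f)); rewrite leq_addl.
Qed.

(** [Poly y] is the generic linear form [y_0 + y_1 u + y_2 u^2 + ...]. *)
Lemma generic_regular N y x : is_ideal N -> ideal_gen [set` y] x ->
    (forall z, N (x * z) -> N z) ->
  forall z, poly_ext N (Poly y * z) -> poly_ext N z.
Proof.
move=> idN yx Nx z; apply: mccoy => // m Nym; apply: Nx.
apply: (ideal_gen_mulr idN _ yx) => _ /(nthP 0)[i _ <-].
by rewrite -coef_Poly.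
Qed.

(** The generic form [theta] is regular modulo [N] and [N + (x)], and [x] is
    regular modulo [N]; exchanging the two, [x] is regular modulo
    [N + (theta)].  Only the last element of the sequence is lost, because
    nothing ensures that [theta] is regular modulo the full sequence. *)
Lemma regular_mod_generic N y x s : is_ideal N ->
    (forall a, a \in x :: s -> ideal_gen [set` y] a) ->
  regular_mod N (x :: s) ->
  regular_mod (adjoin (poly_ext N) (Poly y)) (map polyC (belast x s)).
Proof.
elim: s x N => [//|x2 s IHs] x N idN ys [Nx reg2].
have idNx := adjoin_ideal x idN; have idNu := poly_ext_ideal idN.
have reg_y := generic_regular idN (ys x (mem_head _ _)) Nx.
have reg_y2 : forall z, _ := generic_regular idNx
   (ys x2 (mem_behead (s := x :: _) (mem_head _ _))) reg2.1.
split; last first.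
  change (regular_mod (adjoin (adjoin (poly_ext N) (Poly y)) x%:P)
                      (map polyC (belast x2 s))).
  rewrite adjoinAC -poly_ext_adjoin //; apply: IHs => // a sa.
  by apply: ys; rewrite inE sa orbT.
move=> z [n [w [Nn eq_xz]]].
have : poly_ext (adjoin N x) (Poly y * w).
  rewrite poly_ext_adjoin //; exists (- n), z.
  by split; [exact: (is_idealN idNu)|rewrite eq_xz; ring].
move=> /reg_y2; rewrite poly_ext_adjoin // => -[n' [w' [Nn' eq_w]]].
exists (z - Poly y * w'), w'; split; last by rewrite subrK.
have Nxz : poly_ext N (x%:P * (z - Poly y * w')).
  have -> : x%:P * (z - Poly y * w') = n + Poly y * n'.
    by rewrite mulrBr eq_xz eq_w; ring.
  by apply: (is_idealD idNu) => //; exact: (is_idealMl idNu).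
by move=> i; apply: Nx; rewrite -coefCM.
Qed.

Lemma ideal_gen_polyC y x :
  ideal_gen [set` y] x -> ideal_gen [set` map polyC y] x%:P.
Proof.
have [J0 JD JM] := ideal_gen_is_ideal [set` map polyC y].
apply: (@ideal_gen_min _ _ [set a | ideal_gen [set` map polyC y] a%:P]).
  split=> [|a b|a b] /=; first by rewrite polyC0.
    by rewrite polyCD; exact: JD.
  by rewrite polyCM; exact: JM.
by move=> a ya; apply: ideal_gen_sub => /=; rewrite map_f.
Qed.

End Extensions.

(** * Hilbert functions and regular sequences *)

Definition component (R : comNzRingType) (pi : nat -> {additive R -> R})
  (k : nat) : set R := [set a | pi k a = a].

(** A grading is given by the projections [pi k] onto the components; only
    the properties of a [D]-algebra generated by elements [y] of degree one
    that survive adjoining a variable of degree zero are recorded. *)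
Record standard_graded (D R : comNzRingType) (phi : D -> R)
    (pi : nat -> {additive R -> R}) (y : seq R) : Prop := StandardGraded {
  sg_scale : forall k c a, pi k (phi c * a) = phi c * pi k a;
  sg_proj : forall k a, pi k (pi k a) = pi k a;
  sg_shift0 : forall i a, pi 0 (y`_i * a) = 0;
  sg_shift : forall k i a, pi k.+1 (y`_i * a) = y`_i * pi k a;
  sg_gen : forall k a, pi k.+1 a = a -> exists c : nat -> R,
    (forall i, pi k (c i) = c i) /\ a = \sum_(i < size y) y`_i * c i }.

Definition homogeneous_set (R : comNzRingType) (pi : nat -> {additive R -> R})
  (N : set R) : Prop := forall k a, N a -> N (pi k a).

Definition poly_proj (R : comNzRingType) (pi : nat -> {additive R -> R})
  (k : nat) : {additive {poly R} -> {poly R}} := map_poly (pi k).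

Section Graded.
Variables (D : idomainType) (R : comNzRingType) (phi : {rmorphism D -> R}).
Variables (pi : nat -> {additive R -> R}) (y : seq R).
Hypothesis sgR : standard_graded phi pi y.
Implicit Types (N W : set R).

Lemma poly_ext_component k :
  poly_ext (component pi k) = component (poly_proj pi) k.
Proof.
apply/seteqP; split=> p Wp; last first.
  by move=> i; rewrite /component /= -[in RHS]Wp coef_map.
by apply/polyP => i; rewrite coef_map; exact: Wp.
Qed.

Lemma polyC_nth i : (map polyC y)`_i = (y`_i)%:P.
Proof.
have [lt_iy|le_yi] := ltnP i (size y); first by rewrite (nth_map 0).
by rewrite !nth_default ?size_map // polyC0.
Qed.

Lemma poly_standard_graded :
  standard_graded (map_poly phi) (poly_proj pi) (map polyC y).
Proof.
split.
- move=> k c a; apply/polyP => i; rewrite coef_map !coefM raddf_sum /=.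
  by apply: eq_bigr => j _; rewrite !coef_map /= (sg_scale sgR).
- by move=> k a; apply/polyP => i; rewrite !coef_map /= (sg_proj sgR).
- move=> i a; apply/polyP => j.
  by rewrite coef_map polyC_nth coefCM /= (sg_shift0 sgR) coef0.
- move=> k i a; apply/polyP => j.
  by rewrite coef_map polyC_nth !coefCM coef_map /= (sg_shift sgR).
- move=> k a ak.
  have /choice[c cP] i : exists c : nat -> R, (forall j, pi k (c j) = c j) /\
      a`_i = \sum_(j < size y) y`_j * c j.
    by apply: (sg_gen sgR); rewrite -[in RHS]ak coef_map.
  exists (fun j => \poly_(i < size a) c i j); split.
    move=> j; apply/polyP => i; rewrite coef_map coef_poly /=.
    by case: ifP => _; rewrite ?raddf0 // (cP i).1.
  apply/polyP => i; rewrite coef_sum size_map.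
  under eq_bigr => j _ do rewrite polyC_nth coefCM coef_poly.
  have [_|le_ai] := ltnP; first by rewrite (cP i).2.
  by rewrite nth_default // big1 // => j _; rewrite mulr0.
Qed.

Lemma homogeneous_poly_ext N : homogeneous_set pi N ->
  homogeneous_set (poly_proj pi) (poly_ext N).
Proof. by move=> hN k p Np i; rewrite coef_map; exact: hN. Qed.

(** A basis remains one after adjoining a variable: relations are read off
    coefficient by coefficient, and the finitely many denominators that occur in
    the coefficients of a polynomial are multiplied together. *)
Lemma has_rank_poly_ext W N d : is_ideal N -> W 0 ->
  has_rank phi W N d -> has_rank (map_poly phi) (poly_ext W) (poly_ext N) d.
Proof.
move=> idN W0 [T [b [dE Wb fb sb]]]; exists T, (fun i => (b i)%:P).
have coefS (c : T -> {poly D}) k :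
    (\sum_i map_poly phi (c i) * (b i)%:P)`_k = \sum_i phi (c i)`_k * b i.
  rewrite coef_sum; apply: eq_bigr => i _.
  by rewrite coefMC coef_map.
split=> // [i k|c Nc i|p Wp].
- by rewrite coefC; case: ifP.
- by apply/polyP => k; rewrite coef0; have := Nc k; rewrite coefS => /fb.
have /choice[c0 /choice[c cP]] := fun e => sb _ (Wp e).
exists (\prod_(e < size p) c0 e)%:P.
exists (fun i => \poly_(e < size p)
  ((\prod_(e' < size p | e' != e :> nat) c0 e') * c e i)).
split.
  rewrite polyC_eq0; apply/prodf_neq0 => e _; exact: (cP e).1.
move=> e; rewrite coefB coefS /= map_polyC coefCM /=.
have [lt_ep|le_pe] := ltnP e (size p); last first.
  rewrite nth_default // mulr0 big1 ?subr0 => [|i _]; first exact: is_ideal0.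
  by rewrite coef_poly ltnNge le_pe rmorph0 mul0r.
pose v := \prod_(e' < size p | e' != e :> nat) c0 e'.
have -> : \sum_i phi (\poly_(e < size p)
    ((\prod_(e' < size p | e' != e :> nat) c0 e') * c e i))`_e * b i =
    phi v * \sum_i phi (c e i) * b i.
  rewrite mulr_sumr; apply: eq_bigr => i _.
  by rewrite coef_poly lt_ep rmorphM mulrA.
rewrite (bigD1 (Ordinal lt_ep)) //= -/v mulrC rmorphM.
have -> : forall s, p`_e * (phi (c0 e) * phi v) - phi v * s =
  phi v * (phi (c0 e) * p`_e - s) by move=> s; ring.
by apply: is_idealMl => //; exact: (cP e).2.
Qed.

Lemma sg_shift_generic0 a : poly_proj pi 0 (Poly y * a) = 0.
Proof.
apply/polyP => i; rewrite coef_map coefM raddf_sum coef0 big1 // => j _.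
by rewrite coef_Poly /= (sg_shift0 sgR).
Qed.

Lemma sg_shift_generic k a :
  poly_proj pi k.+1 (Poly y * a) = Poly y * poly_proj pi k a.
Proof.
apply/polyP => i; rewrite coef_map !coefM raddf_sum; apply: eq_bigr => j _.
by rewrite coef_Poly coef_map /= (sg_shift sgR).
Qed.

(** Degree [k.+1] is generated by products with degree [k], and a product with
    a torsion element is torsion. *)
Lemma rank0_succ N k d : is_ideal N ->
    has_rank phi (component pi k) N 0 -> has_rank phi (component pi k.+1) N d ->
  d = 0%N.
Proof.
move=> idN [T0 [b0 [T00 _ _ s0]]] [T [b [<- Wb fb _]]].
have tors a : component pi k a -> exists c, c != 0 /\ N (phi c * a).
  move=> /s0[c0 [c [c00]]]; rewrite big1 ?subr0; first by exists c0.
  by move=> i; have := fintype0 i T00.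
have torsS a : component pi k.+1 a -> exists c, c != 0 /\ N (phi c * a).
  move=> /(sg_gen sgR)[e [ek ->]].
  have /choice[c cP] := fun i => tors _ (ek i).
  exists (\prod_(i < size y) c i); split.
    by apply/prodf_neq0 => i _; exact: (cP i).1.
  rewrite mulr_sumr; apply: ideal_sum => // i _.
  rewrite (bigD1 i) //= rmorphM.
  set v := phi (\prod_(_ | _) _).
  have -> : phi (c i) * v * (y`_i * e i) = v * y`_i * (phi (c i) * e i) by ring.
  by apply: is_idealMl => //; exact: (cP i).2.
apply: eq_card0 => i; rewrite inE; apply/negP => _.
have [c [c0 Nc]] := torsS _ (Wb i).
have /(_ _ i) := fb (fun j => if j == i then c else 0).
rewrite eqxx => c0'; case/eqP: c0; apply: c0'.
rewrite (bigD1 i) //= eqxx big1 ?addr0 // => j /negPf->.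
by rewrite rmorph0 mul0r.
Qed.

End Graded.

Section HyperplaneSection.
Variables (D : idomainType) (R : comNzRingType) (phi : {rmorphism D -> R}).
Variables (pi : nat -> {additive R -> R}) (N : set R) (t : R) (H : nat -> nat).
Hypothesis pi_scale : forall k c a, pi k (phi c * a) = phi c * pi k a.
Hypothesis pi_idem : forall k a, pi k (pi k a) = pi k a.
Hypothesis pi_shift0 : forall a, pi 0 (t * a) = 0.
Hypothesis pi_shift : forall k a, pi k.+1 (t * a) = t * pi k a.
Hypothesis idN : is_ideal N.
Hypothesis homN : homogeneous_set pi N.
Hypothesis regt : forall z, N (t * z) -> N z.
Hypothesis rankN : forall k, has_rank phi (component pi k) N (H k).

Lemma homogeneous_adjoin : homogeneous_set pi (adjoin N t).
Proof.
move=> [|k] _ [n [z [Nn ->]]]; rewrite raddfD /=.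
  by rewrite pi_shift0 addr0; apply: sub_adjoin; exact: homN.
by rewrite pi_shift; exists (pi k.+1 n), (pi k z); split=> //; exact: homN.
Qed.

(** Multiplication by the regular form [t] of degree one embeds degree [k] of
    the quotient by [N] into degree [k.+1], with cokernel the quotient by
    [N + (t)]; so the new ranks are the differences of the old ones. *)
Lemma rank_hyperplane_section : exists H' : nat -> nat,
  (forall k, has_rank phi (component pi k) (adjoin N t) (H' k)) /\
  (forall k, H k = \sum_(j < k.+1) H' j)%N.
Proof.
have idN' := adjoin_ideal t idN.
have /choice[H' H'P] k :
    exists d, has_rank phi (component pi k) (adjoin N t) d.
  have [T [b [_ _ _ sb]]] := rankN k; apply: (has_rank_exists (b := b)) => //.
  move=> w /sb[c0 [c [c00 Nc]]]; exists c0, c; split=> //; exact: sub_adjoin.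
exists H'; split=> // k; elim: k => [|k IHk].
  (* In degree zero nothing is divided out: the kernel has rank 0. *)
  rewrite big_ord_recl big_ord0 addn0.
  apply: (has_rank_uniq idN (rankN 0)); rewrite -[H' 0]add0n.
  apply: (has_rankD (W1 := [set 0]) idN idN') (H'P 0) _.
  - exact: sub_adjoin.
  - by move=> _ ->; split;
      [rewrite /component /= raddf0|exact: (is_ideal0 idN')].
  - move=> w Ww [n [z [Nn wE]]]; exists 0 => //.
    by rewrite subr0 -Ww wE raddfD /= pi_shift0 addr0; exact: homN.
  - by move=> c a b; rewrite /component /= raddfD /= pi_scale => -> ->.
  - exists void, (of_void R); split=> [|[]|? ? []|_ ->];
    first by rewrite card_void.
    exists 1, (fun=> 0); rewrite oner_eq0; split=> //.
    by rewrite mulr0 big1 => [|[]]; rewrite subr0; exact: (is_ideal0 idN).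
rewrite big_ord_recr /= -IHk.
apply: (has_rank_uniq idN (rankN k.+1)).
apply: (has_rankD (W1 := [set t * a | a in component pi k]) idN idN')
  (H'P k.+1) _.
- exact: sub_adjoin.
- move=> _ [a Wa <-]; split; first by rewrite /component /= pi_shift Wa.
  by exists 0, a; rewrite add0r; split=> //; exact: is_ideal0.
- move=> w Ww [n [z [Nn wE]]]; exists (t * pi k z).
    by exists (pi k z) => //; rewrite /component /= pi_idem.
  by rewrite -Ww wE raddfD /= pi_shift addrK; exact: homN.
- by move=> c a b; rewrite /component /= raddfD /= pi_scale => -> ->.
have [T [b [dE Wb fb sb]]] := rankN k.
have tS (c : T -> D) :
    \sum_i phi (c i) * (t * b i) = t * \sum_i phi (c i) * b i.
  by rewrite mulr_sumr; apply: eq_bigr => i _; ring.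
exists T, (fun i => t * b i); split=> [//|i|c|_ [a /sb[c0 [c [c00 Nc]]] <-]].
- by exists (b i).
- by rewrite tS => /regt; exact: fb.
- exists c0, c; split=> //.
  by rewrite tS mulrCA -mulrBr; exact: is_idealMl.
Qed.

End HyperplaneSection.

Fixpoint iter_sum (l : nat) (h : nat -> nat) (k : nat) : nat :=
  if l is l'.+1 then (\sum_(j < k.+1) iter_sum l' h j)%N else h k.

(** Each step trades one element of the regular sequence for one generic
    linear form, over the domain and the algebra with one more variable; the
    resulting [h] is the Hilbert function of the last quotient. *)
Lemma hilbert_of_regular_sequence l :
  forall (D : idomainType) (R : comNzRingType) (phi : {rmorphism D -> R})
    (pi : nat -> {additive R -> R}) (y : seq R) (N : set R) (s : seq R)
    (H : nat -> nat),
    standard_graded phi pi y -> is_ideal N -> homogeneous_set pi N ->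
    (forall k, has_rank phi (component pi k) N (H k)) ->
    (forall x, x \in s -> ideal_gen [set` y] x) ->
    regular_mod N s -> size s = l ->
  exists2 h : nat -> nat, (forall k, h k = 0 -> h k.+1 = 0)%N
    & H =1 iter_sum l h.
Proof.
elim: l => [|l IHl] D R phi pi y N s H sgR idN homN rankN ys regs sl.
  exists H => // k Hk0; have := rankN k; rewrite Hk0 => rk0.
  exact: (rank0_succ sgR idN rk0 (rankN k.+1)).
case: s ys regs sl => // x s ys regs [sl].
have idNu := poly_ext_ideal idN.
have sgu := poly_standard_graded sgR.
have homNu := homogeneous_poly_ext homN.
have rankNu k : has_rank (map_poly phi) (component (poly_proj pi) k)
    (poly_ext N) (H k).
  rewrite -poly_ext_component; apply: has_rank_poly_ext => //.
  by rewrite /component /= raddf0.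
have regy := generic_regular idN (ys x (mem_head _ _)) regs.1.
have homNy := homogeneous_adjoin (sg_shift_generic0 sgR)
  (sg_shift_generic sgR) homNu.
have [H' [rankH' HH']] := rank_hyperplane_section (sg_scale sgu) (sg_proj sgu)
  (sg_shift_generic0 sgR) (sg_shift_generic sgR) idNu homNu regy rankNu.
have [||h hP H'h] := IHl _ _ _ _ _ _ _ _ sgu (adjoin_ideal _ idNu) homNy rankH'
  _ (regular_mod_generic idN ys regs).
- move=> _ /mapP[a sa ->]; apply: ideal_gen_polyC; apply: ys.
  exact: mem_belast sa.
- by rewrite size_map size_belast.
- by exists h => // k; rewrite HH' /=; apply: eq_bigr => j _; rewrite H'h.
Qed.

(** * The numerical argument *)

Lemma eq_iter_sum l (h g : nat -> nat) : h =1 g -> iter_sum l h =1 iter_sum l g.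
Proof.
by move=> hg; elim: l => [|l IHl] k //=; apply: eq_bigr => j _; exact: IHl.
Qed.

Lemma leq_iter_sum l (h g : nat -> nat) : (forall k, g k <= h k)%N ->
  forall k, (iter_sum l g k <= iter_sum l h k)%N.
Proof.
by move=> gh; elim: l => [|l IHl] k //=; apply: leq_sum => j _; exact: IHl.
Qed.

(** The Hilbert function of a quotient that vanishes from degree two on. *)
Definition two_term (a : nat) (k : nat) : nat :=
  if k is k'.+1 then if k' is 0 then a else 0%N else 1%N.

Lemma iter_sum_two_term l a k : iter_sum l (two_term a) k.+1 =
  ('C(l + k, k.+1) + 'C(l + k - 1, k) * a)%N.
Proof.
suff E j : iter_sum l (two_term a) j =
    ('C(l + j - 1, j) + (0 < j) * 'C(l + j - 2, j - 1) * a)%N.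
  by rewrite E addnS !subSS !subn0 mul1n.
elim: l j => [|l IHl] j.
  case: j => [|[|j]]; first by rewrite bin0.
    by rewrite add0n subnn bin0 !mul1n.
  by rewrite add0n !subSS !subn0 !bin_small.
elim: j => [|j IHj] /=; first by rewrite big_ord_recl big_ord0 IHl !bin0.
rewrite big_ord_recr /= -[X in (X + _)%N]/(iter_sum l.+1 (two_term a) j) IHj
  IHl.
rewrite !addnS !addSn !subSS !subn0 !mul1n binS.
case: j {IHj} => [|j]; first by rewrite !bin0; lia.
by rewrite !addnS !subSS !subn0 /= !mul1n binS; lia.
Qed.

(** The excess at index 2 is counted in every partial sum that reaches it. *)
Lemma leq_sum_at2 (h g : nat -> nat) c k : (forall j, g j <= h j)%N ->
    (g 2 + c <= h 2)%N -> (2 <= k)%N ->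
  (\sum_(j < k.+1) g j + c <= \sum_(j < k.+1) h j)%N.
Proof.
move=> gh gh2 k2; have lt2 : (2 < k.+1)%N by [].
rewrite (bigD1 (Ordinal lt2)) //= [X in (_ <= X)%N](bigD1 (Ordinal lt2)) //=.
rewrite addnAC; apply: leq_add => //; exact: leq_sum.
Qed.

(** The formula says that [H k] is the iterated sum of the truncation [g] of
    [h] to degrees 0 and 1.  For [l > 0] the iterated sums of [h] exceed those
    of [g] by at least [h 2] from degree two on, so one instance of the formula
    gives [h 2 = 0].  For [l = 0] the sums are not formed, the formula in degree
    [k] is [H k = 0], and vanishing must be carried down to degree two by the
    separate hypothesis. *)
Lemma hilbert_formula_propagates l (H h : nat -> nat) :
    let formula k := (H k)%:Z =
      'C(l + k - 2, k - 1)%:Z * (H 1)%:Z - (k - 1)%N%:Z * 'C(l + k - 2, k)%:Z in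
    h 0 = 1%N -> (forall k, h k = 0 -> h k.+1 = 0)%N -> H =1 iter_sum l h ->
    (l = 0 -> forall k, 0 < k -> H k = 0 -> H 2 = 0)%N ->
  forall k, (2 <= k)%N -> formula k -> forall j, (2 <= j)%N -> formula j.
Proof.
move=> formula h0 hS Hh H20.
have iter1 m : iter_sum m h 1 = (h 1 + m)%N.
  elim: m => [|m IHm] /=; first by rewrite addn0.
  rewrite big_ord_recr big_ord1 /= IHm.
  suff -> : iter_sum m h 0 = 1%N by rewrite add1n addnS.
  by elim: m {IHm} => //= m; rewrite big_ord1.
pose g := two_term (h 1).
have formulaE k : (2 <= k)%N -> formula k <-> H k = iter_sum l g k.
  case: k => [|[|k]] // _; rewrite /formula (Hh 1%N) iter1 iter_sum_two_term.
  rewrite !addnS !subSS !subn0 binS.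
  have E : (l * 'C(l + k, k.+1) =
            k.+2 * 'C(l + k, k.+2) + 'C(l + k, k.+1))%N.
    rewrite mul_bin_left; case: (l) => [|m]; first by rewrite add0n bin_small
      // !muln0.
    by rewrite addSn subSS addnK mulSn addnC.
  rewrite PoszD mulrDr -!PoszM (mulnC _ l) E mulSn {E}.
  move: (H _) 'C(_, k.+1) 'C(_, k.+2) (h 1) => u c1 c2 a; clear; split; lia.
have gh k : (g k <= h k)%N by case: k => [|[|k]] //=; rewrite h0.
have gh2 m : (iter_sum m g 2 + h 2 <= iter_sum m h 2)%N.
  by elim: m => //= m IHm; apply: leq_sum_at2 => // j; exact: leq_iter_sum.
move=> k k2 /(formulaE _ k2) Hk j j2; apply/formulaE => //.
suff h20 : h 2 = 0%N.
  rewrite Hh; apply: eq_iter_sum => -[|[|i]] //=.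
  by elim: i => // i; exact: hS.
case: l Hh H20 Hk {iter1 formulaE formula} => [|m] Hh H20 Hk.
  have Hk0 : H k = 0%N by rewrite Hk; case: k k2 {Hk} => [|[|k]].
  by rewrite -[h 2]/(iter_sum 0 h 2) -Hh; exact: H20 erefl k (ltnW k2) Hk0.
have := leq_sum_at2 (leq_iter_sum m gh) (gh2 m) k2.
by rewrite -[X in (X + _ <= _)%N]Hk Hh /= -[X in (_ <= X)%N]addn0 leq_add2l
  leqn0 => /eqP.
Qed.

(** * Minimal numbers of generators *)

Section MinimalGenerators.
Variables (K : fieldType) (n : nat).
Implicit Types (Q W : set {mpoly K[n]}) (p f : {mpoly K[n]}).

Let mpolyC_rm : {rmorphism K -> {mpoly K[n]}} := @mpolyC n K.

Lemma sub_const_max_ideal p : max_ideal (p - (p.@[fun=> 0])%:MP).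
Proof.
have [M0 MD MM] := ideal_gen_is_ideal (range (fun i : 'I_n =>
  'X_i : {mpoly K[n]})).
elim/mpolyind: p => [|c m p _ _ IHp]; first by rewrite meval0 subr0.
rewrite mevalD mpolyCD opprD addrACA; apply: MD => //.
rewrite mevalZ mpolyCM -mul_mpolyC -mulrBr; apply: (MM).
have [->|m0] := eqVneq m 0%MM.
  by rewrite mpolyX0 meval1 subrr.
have [i mi] : exists i, m i != 0%N.
  apply: contrapT => Nm; case/eqP: m0; apply/mnmP => i; rewrite mnm0E.
  by apply: contrapT => /eqP mi; apply: Nm; exists i.
rewrite mevalX (bigD1 i) //= expr0n (negPf mi) mul0r subr0.
have -> : m = (U_(i) + (m - U_(i)))%MM.
  by rewrite addmC submK // lep1mP.
by rewrite mpolyXD mulrC; apply: MM; apply: ideal_gen_sub; exists i.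
Qed.

(** Modulo [m Q] the coefficients of a combination of generators can be
    replaced by their constant terms. *)
Lemma gens_span_mod_max Q (T : finType) (b : T -> {mpoly K[n]}) :
    ideal_gen (range b) = Q ->
  forall a, Q a -> torsion_span mpolyC_rm (ideal_mul (@max_ideal K n) Q) b a.
Proof.
move=> bQ a Qa.
have idmQ : is_ideal (ideal_mul (@max_ideal K n) Q) := ideal_gen_is_ideal _.
have idQ : is_ideal Q by rewrite -bQ; exact: ideal_gen_is_ideal.
have Qb i : Q (b i) by rewrite -bQ; apply: ideal_gen_sub; exists i.
suff : [set a | exists c : T -> K,
    ideal_mul (@max_ideal K n) Q (a - \sum_i (c i)%:MP * b i)] a.
  move=> [c Nc]; exists 1, c; split; first exact: oner_neq0.
  by rewrite rmorph1 mul1r.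
move: a Qa; rewrite -{1}bQ; apply: ideal_gen_min; last first.
  move=> _ [i _ <-]; exists (fun j => (j == i)%:R).
  rewrite (bigD1 i) //= eqxx mpolyC1 mul1r big1 ?addr0 ?subrr.
    exact: (is_ideal0 idmQ).
  by move=> j /negPf->; rewrite mpolyC0 mul0r.
split.
- exists (fun=> 0); rewrite big1 ?subr0; first exact: (is_ideal0 idmQ).
  by move=> i _; rewrite mpolyC0 mul0r.
- move=> x1 x2 [c1 N1] [c2 N2]; exists (fun i => c1 i + c2 i).
  have -> : \sum_i (c1 i + c2 i)%:MP * b i =
      \sum_i (c1 i)%:MP * b i + \sum_i (c2 i)%:MP * b i.
    by rewrite -big_split; apply: eq_bigr => i _; rewrite mpolyCD mulrDl.
  by rewrite opprD addrACA; exact: (is_idealD idmQ).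
- move=> r x [c Nc]; exists (fun i => r.@[fun=> 0] * c i).
  have -> : \sum_i (r.@[fun=> 0] * c i)%:MP * b i =
      (r.@[fun=> 0])%:MP * \sum_i (c i)%:MP * b i.
    by rewrite mulr_sumr; apply: eq_bigr => i _; rewrite mpolyCM mulrA.
  have -> : forall s r0, r * x - r0 * s = r * (x - s) + (r - r0) * s.
    by move=> *; ring.
  apply: (is_idealD idmQ); first exact: (is_idealMl idmQ).
  apply: ideal_gen_sub; exists (r - (r.@[fun=> 0])%:MP),
    (\sum_i (c i)%:MP * b i).
  split=> //; first exact: sub_const_max_ideal.
  by apply: ideal_sum => // i _; exact: (is_idealMl idQ).
Qed.

(** Any generating set spans [Q / m Q], so it is at least as large as a
    basis. *)
Lemma min_num_gensE Q (T : finType) (b : T -> {mpoly K[n]}) :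
    ideal_gen (range b) = Q ->
    free_mod mpolyC_rm (ideal_mul (@max_ideal K n) Q) b ->
  min_num_gens Q = #|T|.
Proof.
move=> bQ fb; rewrite /min_num_gens.
set E := [set e | exists s : seq {mpoly K[n]}, size s = e /\
  ideal_gen [set` s] = Q].
have Emin : is_minimum E #|T|.
  split.
    exists (codom b); split; first by rewrite size_codom.
    rewrite -bQ; congr ideal_gen; apply/seteqP; split=> x /=.
      by move=> /codomP[i ->]; exists i.
    by move=> [i _ <-]; exact: codom_f.
  move=> e [s [<- sQ]]; pose bs (i : 'I_(size s)) := s`_i.
  have bsQ : ideal_gen (range bs) = Q.
    rewrite -sQ; congr ideal_gen; apply/seteqP; split=> x /=.
      by move=> [i _ <-]; exact: mem_nth.
    by move=> /(nthP 0)[i lt_i <-]; exists (Ordinal lt_i).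
  rewrite -[X in (_ <= X)%N]card_ord; apply: (card_free_leq _ fb).
    exact: ideal_gen_is_ideal.
  move=> i; apply: (gens_span_mod_max bsQ).
  by rewrite -bQ; apply: ideal_gen_sub; exists i.
have /getPex[Eg gmin] : exists r, is_minimum E r by exists #|T|.
by apply/eqP; rewrite eqn_leq gmin ?Emin.2 //; exact: Emin.1.
Qed.

Definition order_ge (e : nat) : set {mpoly K[n]} :=
  [set p | forall m, m \in msupp p -> (e <= mdeg m)%N].

Lemma order_geM e1 e2 p1 p2 :
  order_ge e1 p1 -> order_ge e2 p2 -> order_ge (e1 + e2) (p1 * p2).
Proof.
move=> o1 o2 m /msuppM_le /allpairsP[[m1 m2] /= [s1 s2 ->]].
by rewrite mdegD leq_add ?o1 ?o2.
Qed.

Lemma order_ge_ideal e : is_ideal (order_ge e).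
Proof.
split=> [m|p q op oq m|a p op]; first by rewrite msupp0.
  by move=> /msuppD_le; rewrite mem_cat => /orP[/op|/oq].
by rewrite -[e]add0n; apply: order_geM => // m.
Qed.

Lemma max_ideal_mul_order Q W e : Q = ideal_gen W ->
    (forall f, W f -> f \is e.-homog) ->
  ideal_mul (@max_ideal K n) Q `<=` order_ge e.+1.
Proof.
move=> QW We; apply: ideal_gen_min; first exact: order_ge_ideal.
move=> _ [x [y [mx Qy ->]]]; rewrite -add1n; apply: order_geM.
  move: x mx; apply: ideal_gen_min; first exact: order_ge_ideal.
  by move=> _ [i _ <-] m; rewrite msuppX inE => /eqP->; rewrite mdeg1.
move: y Qy; rewrite QW; apply: ideal_gen_min; first exact: order_ge_ideal.
by move=> f /We/dhomogP hf m /hf->.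
Qed.

Lemma homog_order_gt0 e p : p \is e.-homog -> order_ge e.+1 p -> p = 0.
Proof.
move=> /dhomogP hp op; apply/eqP; rewrite -msupp_eq0; move: hp op.
rewrite /order_ge /=; case: (msupp p) => // m s hp /(_ m (mem_head _ _)).
by rewrite (hp m (mem_head _ _)) ltnn.
Qed.

(** A family in [W] that is a basis of the span of [W] over [K] generates [Q],
    and it stays free modulo [m Q] because [m Q] has no nonzero element of
    degree [e]. *)
Lemma minimal_homogeneous_basis Q W e : Q = ideal_gen W ->
    (forall f, W f -> f \is e.-homog) ->
  exists (T : finType) (b : T -> {mpoly K[n]}),
    [/\ forall i, W (b i), ideal_gen (range b) = Q,
        free_mod mpolyC_rm (ideal_mul (@max_ideal K n) Q) b
      & #|T| = min_num_gens Q].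
Proof.
move=> QW We.
have id0 := zero_is_ideal {mpoly K[n]}.
pose X (m : 'X_{1..n < e.+1}) : {mpoly K[n]} := 'X_[m].
have spanX w : W w -> torsion_span mpolyC_rm [set 0] X w.
  move=> Ww; exists 1, (fun m : 'X_{1..n < e.+1} => w@_m); split;
    first exact: oner_neq0.
  rewrite rmorph1 mul1r /= [X in X - _](@mpolywE _ _ e.+1).
    by apply/eqP; rewrite subr_eq0; apply/eqP; apply: eq_bigr => m _;
      rewrite mul_mpolyC.
  rewrite msizeE; apply/bigmax_leqP_seq => m mw _.
  by rewrite (dhomogP _ _ _ (We _ Ww)).
have [d [T [b [dE Wb fb sb]]]] := has_rank_exists id0 spanX.
have bQ : ideal_gen (range b) = Q.
  rewrite QW; apply/seteqP; split; apply: ideal_gen_min;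
      try exact: ideal_gen_is_ideal.
    by move=> _ [i _ <-]; exact: ideal_gen_sub.
  move=> w /sb[c0 [c [c00 /= wE]]].
  have -> : w = \sum_i ((c0^-1 * c i)%:MP * b i).
    transitivity ((c0^-1)%:MP * ((c0)%:MP * w)).
      by rewrite mulrA -mpolyCM mulVf // mpolyC1 mul1r.
    rewrite (subr0_eq wE) mulr_sumr; apply: eq_bigr => i _.
    by rewrite mpolyCM mulrA.
  apply: ideal_sum => [|i _]; first exact: ideal_gen_is_ideal.
  apply: (is_idealMl (ideal_gen_is_ideal _)); apply: ideal_gen_sub; by exists i.
have fQ : free_mod mpolyC_rm (ideal_mul (@max_ideal K n) Q) b.
  move=> c /(max_ideal_mul_order QW We) /homog_order_gt0 H; apply: fb; apply: H.
  by apply: rpred_sum => i _; rewrite /= mul_mpolyC; apply: dhomogZ; exact: We.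
exists T, b; split=> //; by rewrite (min_num_gensE bQ fQ).
Qed.

Lemma min_num_gens_setT : min_num_gens [set: {mpoly K[n]}] = 1%N.
Proof.
rewrite (@min_num_gensE _ unit (fun=> 1)) ?card_unit //.
  apply/seteqP; split=> // p _; rewrite -[p]mulr1.
  by apply: (is_idealMl (ideal_gen_is_ideal _)); apply: ideal_gen_sub;
    exists tt.
move=> c; rewrite (bigD1 tt) //= big1 => [|[]//]; rewrite addr0 mulr1 => mc [].
rewrite -[c tt](@mevalC n _ (fun=> 0)); apply: max_ideal_eval0.
move: mc; apply: ideal_gen_min; first exact: ideal_gen_is_ideal.
by move=> _ [x [y [mx _ ->]]]; exact: (is_idealMr (N := @max_ideal K n)
  (ideal_gen_is_ideal _)).
Qed.

Lemma min_num_gens_set0 : min_num_gens [set 0 : {mpoly K[n]}] = 0%N.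
Proof.
rewrite (@min_num_gensE _ void (of_void _)) ?card_void //.
apply/seteqP; split; last first.
  by move=> _ ->; exact: is_ideal0 (ideal_gen_is_ideal _).
by apply: ideal_gen_min; [exact: zero_is_ideal|move=> _ [[]]].
Qed.

End MinimalGenerators.

(** * Regular sequences and quotients *)

Section RegularTransport.

Lemma ideal_gen_rcons (R : comNzRingType) (t : seq R) x :
  ideal_gen [set` rcons t x] = adjoin (ideal_gen [set` t]) x.
Proof.
have idt := ideal_gen_is_ideal [set` t].
apply/seteqP; split; last first.
  move=> _ [u [z [tu ->]]]; have idx := ideal_gen_is_ideal [set` rcons t x].
  apply: (is_idealD idx).
    move: u tu; apply: ideal_gen_min => // a /= ta.
    by apply: ideal_gen_sub; rewrite /= mem_rcons inE ta orbT.
  apply: (is_idealMr idx); apply: ideal_gen_sub.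
  by rewrite /= mem_rcons mem_head.
apply: ideal_gen_min; first exact: adjoin_ideal.
move=> a /=; rewrite mem_rcons inE => /predU1P[->|ta].
  exists 0, 1; rewrite add0r mulr1; split=> //; exact: (is_ideal0 idt).
by apply: sub_adjoin; exact: ideal_gen_sub.
Qed.

Lemma regular_sequence_mod (R : comNzRingType) (s : seq R) :
  regular_sequence s -> regular_mod [set 0] s.
Proof.
move=> [reg _].
have -> : [set 0] = ideal_gen [set` [::] : seq R].
  apply/seteqP; split.
    by move=> _ ->; exact: is_ideal0 (ideal_gen_is_ideal _).
  by apply: ideal_gen_min; [exact: zero_is_ideal|move=> a; rewrite /= inE].
have {}reg i z : (i < size s)%N ->
    ideal_gen [set` [::] ++ take i s] (s`_i * z) ->
    ideal_gen [set` [::] ++ take i s] z by exact: reg.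
elim: s [::] reg => [//|x s IHs] t reg; split.
  by move=> z; have := reg 0 z isT; rewrite take0 cats0.
rewrite -ideal_gen_rcons; apply: IHs => i z lt_is.
by have := reg i.+1 z lt_is; rewrite /= -cat_rcons.
Qed.

Lemma regular_mod_preimage (A B : comNzRingType) (f : {rmorphism A -> B})
    (N : set B) (s : seq A) : (forall b, exists a, f a = b) ->
  regular_mod N (map f s) -> regular_mod (f @^-1` N) s.
Proof.
move=> fsurj; elim: s N => [//|x s IHs] N [reg regs]; split.
  by move=> z; rewrite /preimage /= rmorphM; exact: reg.
suff -> : adjoin (f @^-1` N) x = f @^-1` adjoin N (f x) by exact: IHs.
apply/seteqP; split=> a.
  by move=> [n [z [Nn ->]]]; exists (f n), (f z); rewrite rmorphD rmorphM.
move=> [n [w [Nn fa]]]; have [z fz] := fsurj w.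
exists (a - x * z), z; rewrite subrK; split=> //.
by rewrite /preimage /= rmorphB rmorphM fz fa addrK.
Qed.

End RegularTransport.

(** * The Rees algebra as a graded algebra *)

Section ReesGrading.
Variables (R : comNzRingType) (I : set R).

Lemma ideal_pow1 : is_ideal I -> ideal_pow I 1 = I.
Proof.
move=> idI; apply/seteqP; split.
  by apply: ideal_gen_min => // _ [x [a [Ix _ ->]]]; exact: is_idealMr.
by move=> x Ix; apply: ideal_gen_sub; exists x, 1; rewrite mulr1.
Qed.

(** [a t^k], where membership of [a] in [I^k] is left to [val_rees_monom]; the
    default value 0 keeps dependent proofs out of sums over such elements. *)
Definition rees_monom (k : nat) (a : R) : rees I := insubd 0 (a *: 'X^k).

Lemma val_rees_monom k a : ideal_pow I k a -> val (rees_monom k a) = a *: 'X^k.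
Proof.
move=> Ia; apply: insubdK; apply/asboolP => j; rewrite coefZ coefXn.
case: eqP => [->|_]; first by rewrite mulr1.
by rewrite mulr0; exact: is_ideal0 (ideal_pow_is_ideal I j).
Qed.

Lemma rees_coef (p : rees I) k : ideal_pow I k (val p)`_k.
Proof. by have /asboolP := valP p; apply. Qed.

Lemma val_reesM (p q : rees I) : val (p * q) = val p * val q.
Proof. by rewrite rmorphM. Qed.

Lemma val_reesB (p q : rees I) : val (p - q) = val p - val q.
Proof. by rewrite rmorphB. Qed.

Definition rees_proj (k : nat) (p : rees I) : rees I := rees_monom k (val p)`_k.

Lemma val_rees_proj k p : val (rees_proj k p) = (val p)`_k *: 'X^k.
Proof. by rewrite val_rees_monom //; exact: rees_coef. Qed.

Lemma rees_proj_is_additive k : zmod_morphism (rees_proj k).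
Proof.
move=> p q; apply: val_inj.
by rewrite rmorphB /= !val_rees_proj rmorphB coefB scalerBl.
Qed.

HB.instance Definition _ k :=
  GRing.isZmodMorphism.Build (rees I) (rees I) (rees_proj k)
    (rees_proj_is_additive k).

Definition rees_const (a : R) : rees I := rees_monom 0 a.

Lemma val_rees_const a : val (rees_const a) = a%:P.
Proof. by rewrite val_rees_monom // expr0 alg_polyC. Qed.

Lemma rees_const_is_additive : zmod_morphism rees_const.
Proof.
by move=> a b; apply: val_inj; rewrite rmorphB /= !val_rees_const polyCB.
Qed.

HB.instance Definition _ :=
  GRing.isZmodMorphism.Build R (rees I) rees_const rees_const_is_additive.

Lemma rees_const_is_monoid_morphism : monoid_morphism rees_const.
Proof.
split; first by apply: val_inj; rewrite rmorph1 val_rees_const.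
by move=> a b; apply: val_inj; rewrite rmorphM /= !val_rees_const polyCM.
Qed.

HB.instance Definition _ :=
  GRing.isMonoidMorphism.Build R (rees I) rees_const
    rees_const_is_monoid_morphism.

(** The projections as additive maps, which is the form a grading takes in
    [standard_graded]. *)
Definition rees_grading (k : nat) : {additive rees I -> rees I} := rees_proj k.

Variable g : seq R.
Hypothesis gI : ideal_gen [set` g] = I.

Lemma nth_gens i : I g`_i.
Proof.
have idI : is_ideal I by rewrite -gI; exact: ideal_gen_is_ideal.
have [lt_ig|le_gi] := ltnP i (size g); last first.
  by rewrite nth_default //; exact: is_ideal0.
by rewrite -gI; apply: ideal_gen_sub => /=; exact: mem_nth.
Qed.

Definition rees_gens : seq (rees I) := map (rees_monom 1) g.

Lemma val_rees_gens i : val rees_gens`_i = g`_i *: 'X.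
Proof.
have idI : is_ideal I by rewrite -gI; exact: ideal_gen_is_ideal.
have [lt_ig|le_gi] := ltnP i (size g).
  rewrite (nth_map 0) // val_rees_monom ?ideal_pow1 //; exact: nth_gens.
by rewrite !nth_default ?size_map // rmorph0 scale0r.
Qed.

Lemma ideal_powS_gens k a : ideal_pow I k.+1 a -> exists c : nat -> R,
  (forall i, ideal_pow I k (c i)) /\ a = \sum_(i < size g) g`_i * c i.
Proof.
have idk := ideal_pow_is_ideal I k.
pose A := [set a | exists c : nat -> R,
  (forall i, ideal_pow I k (c i)) /\ a = \sum_(i < size g) g`_i * c i].
have idA : is_ideal A.
  split.
  - exists (fun=> 0); split; first by move=> _; exact: (is_ideal0 idk).
    by rewrite big1 // => i _; rewrite mulr0.
  - move=> _ _ [c1 [c1I ->]] [c2 [c2I ->]]; exists (fun i => c1 i + c2 i).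
    split; first by move=> i; exact: (is_idealD idk).
    by rewrite -big_split; apply: eq_bigr => i _; rewrite mulrDr.
  - move=> r _ [c [cI ->]]; exists (fun i => r * c i).
    split; first by move=> i; exact: (is_idealMl idk).
    by rewrite mulr_sumr; apply: eq_bigr => i _; rewrite mulrCA.
suff : ideal_mul I (ideal_pow I k) `<=` A by apply.
apply: ideal_gen_min => // _ [x [b [Ix Ib ->]]].
move: x Ix; rewrite -{1}gI; apply: ideal_gen_mulr => // _ /(nthP 0)[i lt_i <-].
exists (fun j => if j == i then b else 0); split.
  by move=> j; case: eqP => // _; exact: (is_ideal0 idk).
rewrite (bigD1 (Ordinal lt_i)) //= eqxx big1 ?addr0 // => j.
by rewrite -val_eqE /= => /negPf->; rewrite mulr0.
Qed.

Lemma rees_grading_gen k (p : rees I) : rees_grading k.+1 p = p ->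
  exists c : nat -> rees I, (forall i, rees_grading k (c i) = c i) /\
    p = \sum_(i < size rees_gens) rees_gens`_i * c i.
Proof.
move=> pk; have [c [cI pE]] := ideal_powS_gens (rees_coef p k.+1).
exists (fun i => rees_monom k (c i)); split.
  move=> i; apply: val_inj; rewrite /= val_rees_proj !val_rees_monom //.
  by rewrite coefZ coefXn eqxx mulr1.
apply: val_inj; rewrite -[in LHS]pk [LHS]val_rees_proj pE raddf_sum size_map.
rewrite scaler_suml; apply: eq_bigr => i _.
rewrite [RHS]val_reesM val_rees_gens val_rees_monom //.
by rewrite -scalerAl -scalerAr scalerA exprS.
Qed.

Lemma rees_standard_graded (K : comNzRingType) (f : K -> R) :
  standard_graded (rees_const \o f) rees_grading rees_gens.
Proof.
split.
- move=> k c a; apply: val_inj.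
  rewrite [LHS]val_rees_proj !val_reesM !val_rees_const [in RHS]val_rees_proj.
  by rewrite coefCM mul_polyC scalerA.
- move=> k a; apply: val_inj.
  by rewrite [LHS]val_rees_proj [RHS]val_rees_proj val_rees_proj coefZ coefXn
    eqxx mulr1.
- move=> i a; apply: val_inj.
  rewrite [LHS]val_rees_proj val_reesM val_rees_gens.
  by rewrite -scalerAl coefZ coefXM mulr0 scale0r rmorph0.
- move=> k i a; apply: val_inj.
  rewrite [LHS]val_rees_proj [RHS]val_reesM val_reesM val_rees_gens
    val_rees_proj.
  rewrite -scalerAl coefZ coefXM /= -scalerAr -scalerAl scalerA.
  by rewrite [_ * (val a)`_k]mulrC exprS.
- exact: rees_grading_gen.
Qed.

Lemma rees_irrelevant_gen (p : rees I) : (val p)`_0 = 0 ->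
  ideal_gen [set` rees_gens] p.
Proof.
move=> p0; have idg := ideal_gen_is_ideal [set` rees_gens].
have -> : p = \sum_(k < size (val p)) rees_proj k p.
  apply: val_inj; rewrite raddf_sum -[LHS]coefK poly_def.
  by apply: eq_bigr => k _; exact/esym/val_rees_proj.
apply: ideal_sum => // -[[|k] lt_k] _ /=.
  have -> : rees_proj 0 p = 0.
    by apply: val_inj; rewrite val_rees_proj p0 scale0r rmorph0.
  exact: is_ideal0.
have [|c [_ ->]] := @rees_grading_gen k (rees_proj k.+1 p).
  by apply: val_inj; rewrite /= !val_rees_proj coefZ coefXn eqxx mulr1.
apply: ideal_sum => // i _; apply: (is_idealMr idg).
by apply: ideal_gen_sub => /=; exact: mem_nth.
Qed.

End ReesGrading.

(** * The fiber cone of an equigenerated ideal *)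

Section FiberCone.
Variables (K : fieldType) (n : nat) (I : set {mpoly K[n]}).
Variables (X : set {mpoly K[n]}) (d : nat).
Hypothesis XI : ideal_gen X = I.
Hypothesis Xd : forall f, X f -> f \is d.-homog.

Let mpolyC_rm : {rmorphism K -> {mpoly K[n]}} := @mpolyC n K.

Lemma ideal_pow_homog_gens k : ideal_pow I k =
  ideal_gen [set f | ideal_pow I k f /\ f \is (d * k).-homog].
Proof.
set G := fun k => [set f | ideal_pow I k f /\ f \is (d * k).-homog].
apply/seteqP; split; last first.
  apply: ideal_gen_min; first exact: ideal_pow_is_ideal.
  by move=> f [].
elim: k => [|k IHk].
  move=> f _; rewrite -[f]mulr1; apply: (is_idealMl (ideal_gen_is_ideal _)).
  by apply: ideal_gen_sub; split=> //; rewrite muln0; exact: dhomog1.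
have idG := ideal_gen_is_ideal (G k.+1).
apply: ideal_gen_min => // _ [x [f [Ix If ->]]].
move: x Ix; rewrite -{1}XI; apply: ideal_gen_mulr => // x Xx.
rewrite mulrC; move: f {If}(IHk _ If); apply: ideal_gen_mulr => // f [If fk].
apply: ideal_gen_sub; split; last first.
  by rewrite mulnS addnC; exact: dhomogM fk (Xd Xx).
rewrite mulrC; apply: ideal_gen_sub; exists x, f; split=> //.
by rewrite -XI; exact: ideal_gen_sub.
Qed.

Lemma power_basis k : exists (T : finType) (b : T -> {mpoly K[n]}),
  [/\ ideal_gen (range b) = ideal_pow I k,
      free_mod mpolyC_rm (ideal_mul (@max_ideal K n) (ideal_pow I k)) b
    & #|T| = min_num_gens (ideal_pow I k)].
Proof.
have Wk f : [set f | ideal_pow I k f /\ f \is (d * k).-homog] f ->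
    f \is (d * k).-homog by case.
have [T [b [_ bQ fb bE]]] :=
  minimal_homogeneous_basis (ideal_pow_homog_gens k) Wk.
by exists T, b.
Qed.

Lemma finite_gens : exists g : seq {mpoly K[n]}, ideal_gen [set` g] = I.
Proof.
have [T [b [_ bI _ _]]] := minimal_homogeneous_basis (esym XI) Xd.
exists (codom b); rewrite -bI; congr ideal_gen; apply/seteqP; split=> x /=.
  by move=> /codomP[i ->]; exists i.
by move=> [i _ <-]; exact: codom_f.
Qed.

(** The kernel of the projection of the Rees algebra onto the fiber cone. *)
Definition fiber_kernel : set (rees I) :=
  [set p | rees_ext (@max_ideal K n) p].

Let phi : {rmorphism K -> rees I} := rees_const I \o mpolyC_rm.

Lemma fiber_kernel_ideal : is_ideal fiber_kernel.
Proof.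
split=> [|p q Np Nq|a p Np]; rewrite /fiber_kernel /=.
- exact: (rpred0 (@rees_ext _ (@max_ideal K n) I)).
- exact: (@rpredD _ (@rees_ext _ (@max_ideal K n) I) p q Np Nq).
- exact: (@ring_quotient.idealMr _ (@rees_ext _ (@max_ideal K n) I) a p Np).
Qed.

Lemma fiber_kernel_homogeneous :
  homogeneous_set (rees_grading I) fiber_kernel.
Proof.
move=> k p /asboolP Np; apply/asboolP => j.
rewrite [val _]val_rees_proj coefZ coefXn; case: eqP => [->|_].
  by rewrite mulr1; exact: Np.
by rewrite mulr0; exact: (is_ideal0 (ideal_gen_is_ideal _)).
Qed.

(** Degree [k] of the Rees algebra modulo the kernel is [I^k / m I^k]. *)
Lemma rees_rank k : has_rank phi (component (rees_grading I) k)
  fiber_kernel (min_num_gens (ideal_pow I k)).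
Proof.
have [T [b [bQ fb bE]]] := power_basis k.
have bI i : ideal_pow I k (b i) by rewrite -bQ; apply: ideal_gen_sub; exists i.
have sumE (c : T -> K) : val (\sum_i phi (c i) * rees_monom I k (b i)) =
    (\sum_i (c i)%:MP * b i) *: 'X^k.
  rewrite raddf_sum scaler_suml; apply: eq_bigr => i _.
  by rewrite [LHS]val_reesM val_rees_const val_rees_monom // mul_polyC scalerA.
exists T, (fun i => rees_monom I k (b i)); split=> //.
- move=> i; apply: val_inj.
  by rewrite [LHS]val_rees_proj val_rees_monom // coefZ coefXn eqxx mulr1.
- move=> c /asboolP /(_ k); rewrite sumE coefZ coefXn eqxx mulr1; exact: fb.
- move=> p pk.
  have [c0 [c [c00 Nc]]] := gens_span_mod_max bQ (rees_coef p k).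
  exists c0, c; split=> //; apply/asboolP => j.
  have -> : val (phi c0 * p - \sum_i phi (c i) * rees_monom I k (b i)) =
     (c0%:MP * (val p)`_k - \sum_i (c i)%:MP * b i) *: 'X^k.
    rewrite val_reesB sumE val_reesM val_rees_const -[in LHS]pk.
    rewrite [in LHS]val_rees_proj.
    by rewrite mul_polyC scalerA scalerBl.
  rewrite coefZ coefXn; case: eqP => [->|_]; first by rewrite mulr1.
  by rewrite mulr0; exact: (is_ideal0 (ideal_gen_is_ideal _)).
Qed.

End FiberCone.

Section FiberConeRegular.
Variables (K : fieldType) (n : nat) (I : set {mpoly K[n]}).

(** Regularity is transported from the fiber cone to the Rees algebra modulo
    the kernel, which spares a second grading on the quotient ring. *)
Lemma lift_regular_sequence (s : seq (fiber_cone I)) :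
    (forall x, x \in s -> @fiber_cone_max K n I x) -> regular_sequence s ->
  exists p : seq (rees I), [/\ size p = size s,
    forall x, x \in p -> (val x)`_0 = 0
    & regular_mod (fiber_kernel (I := I)) p].
Proof.
move=> sJ regs.
pose Q : comNzRingType := {ideal_quot (@rees_ext _ (@max_ideal K n) I)}.
pose f : {rmorphism rees I -> Q} :=
  \pi_({ideal_quot (@rees_ext _ (@max_ideal K n) I)}).
have [p [sE p0]] : exists p : seq (rees I), map f p = s /\
    forall x, x \in p -> (val x)`_0 = 0.
  elim: s sJ {regs} => [|x s IHs] sJ; first by exists [::].
  have [|p [<- p0]] := IHs; first by move=> y ys; apply: sJ;
    rewrite inE ys orbT.
  have [q q0 ->] := sJ x (mem_head _ _).
  by exists (q :: p); split=> // y; rewrite inE => /predU1P[->|/p0].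
exists p; split=> //; first by rewrite -sE size_map.
have -> : fiber_kernel (I := I) = f @^-1` [set 0].
  apply/seteqP; split=> q; rewrite /fiber_kernel /preimage /=.
    move=> Nq; apply/eqP; rewrite -(rmorph0 f) -Quotient.idealrBE subr0;
      exact: Nq.
  by move=> /eqP; rewrite -(rmorph0 f) -Quotient.idealrBE subr0.
apply: regular_mod_preimage => [x|]; first by exists (repr x); exact: reprK.
by rewrite sE; exact: regular_sequence_mod.
Qed.

End FiberConeRegular.

Lemma exprn_ideal_pow (R : comNzRingType) (I : set R) x k :
  I x -> ideal_pow I k (x ^+ k).
Proof.
move=> Ix; elim: k => // k IHk; apply: ideal_gen_sub.
by exists x, (x ^+ k); rewrite exprS.
Qed.

(** [h 0 = 1] because degree 0 of the fiber cone is [K]. *)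
Lemma hilbert_function_fiber_cone (K : fieldType) (n : nat)
    (I : set {mpoly K[n]}) (s : seq (fiber_cone I)) :
    equigenerated I ->
    (forall x, x \in s -> @fiber_cone_max K n I x) -> regular_sequence s ->
  exists h : nat -> nat, [/\ h 0 = 1%N, (forall k, h k = 0 -> h k.+1 = 0)%N
    & (fun k => min_num_gens (ideal_pow I k)) =1 iter_sum (size s) h].
Proof.
move=> [X [d [[XI _] Xd]]] sJ regs.
have [g gI] := finite_gens XI Xd.
have [p [sp p0 regp]] := lift_regular_sequence sJ regs.
have [|h hS Hh] := hilbert_of_regular_sequence (rees_standard_graded gI _)
  (fiber_kernel_ideal I) (@fiber_kernel_homogeneous K n I)
  (rees_rank XI Xd) _ regp sp.
  by move=> x /p0; exact: rees_irrelevant_gen.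
exists h; split=> //.
have <- : iter_sum (size s) h 0 = h 0.
  by elim: (size s) => //= m; rewrite big_ord1.
by rewrite -Hh /= min_num_gens_setT.
Qed.

(** Powers of a nonzero element of a domain are nonzero, so a power of [I]
    without generators forces [I = 0]. *)
Lemma min_num_gens_pow_eq0 (K : fieldType) (n : nat)
    (I : set {mpoly K[n]}) j k :
    equigenerated I -> (0 < j)%N -> min_num_gens (ideal_pow I k) = 0%N ->
  min_num_gens (ideal_pow I j) = 0%N.
Proof.
move=> [X [d [[XI _] Xd]]]; case: j => // j _ mu0.
have [T [b [bQ _]]] := power_basis XI Xd k; rewrite mu0 => T0.
have id0 := zero_is_ideal {mpoly K[n]}.
have Ik0 f : ideal_pow I k f -> f = 0.
  rewrite -bQ; apply: (ideal_gen_min id0) => _ [i _ <-].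
  by have := fintype0 i T0.
have I0 f : I f -> f = 0.
  move=> /(exprn_ideal_pow k)/Ik0/eqP; rewrite expf_eq0 => /andP[_ /eqP//].
rewrite -(@min_num_gens_set0 K n); congr min_num_gens; apply/seteqP; split.
  by apply: ideal_gen_min => // _ [x [y [/I0-> _ ->]]]; rewrite /= mul0r.
by move=> _ ->; exact: is_ideal0 (ideal_pow_is_ideal I j.+1).
Qed.

Theorem corollary1p9 (K : fieldType) (n : nat) (I : set {mpoly K[n]})
    (Imon : monomial_ideal I) (Iequi : equigenerated I)
    (FCM : graded_cohen_macaulay (@fiber_cone_max K n I)) :
  let l := analytic_spread I in
  let mu_formula (k : nat) :=
    (min_num_gens (ideal_pow I k))%:Z =
      'C(l + k - 2, k - 1)%:Z * (min_num_gens I)%:Z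
      - (k - 1)%N%:Z * 'C(l + k - 2, k)%:Z in
  (freiman I <-> (forall k : nat, (2 <= k)%N -> mu_formula k)) /\
  (freiman I <-> (exists k : nat, (2 <= k)%N /\ mu_formula k)).
Proof.
move=> l mu_formula.
have idI : is_ideal I.
  by have [X [d [[<- _] _]]] := Iequi; exact: ideal_gen_is_ideal.
have [d [dimF [[s [sd sJ regs]] _]]] := FCM.
have ld : l = d.
  have /getPex[lP lmax] : exists e, is_krull_dim (fiber_cone I) e by exists d.
  by apply/eqP; rewrite eqn_leq dimF.2 ?lmax //; exact: dimF.1.
have [h [h0 hS Hh]] := hilbert_function_fiber_cone Iequi sJ regs.
have propagate k : (2 <= k)%N -> mu_formula k ->
    forall j, (2 <= j)%N -> mu_formula j.
  have := hilbert_formula_propagates h0 hS Hh.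
  rewrite sd -ld; cbv beta zeta; rewrite (ideal_pow1 idI); apply=> _ i _.
  exact: min_num_gens_pow_eq0.
have freimanE : freiman I <-> mu_formula 2.
  rewrite /freiman /mu_formula addnK bin1 mul1r.
  by split=> [[]|].
split; split.
- by move=> /freimanE; exact: propagate.
- by move=> H; apply/freimanE; exact: H.
- by move=> /freimanE; exists 2.
- by move=> [k [k2 Hk]]; apply/freimanE; exact: propagate Hk _ _.
Qed.
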